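(* Let $m,n$ be positive integers. The map $\psi(\alpha)=(\alpha^E_m,\alpha^E_{m-1},\dots,\alpha^E_2,0)$ is an involution on $S_{m,n}$ (i.e. $\psi$ maps $S_{m,n}$ to itself and $\psi(\psi(\alpha))=\alpha$ for all $\alpha\in S_{m,n}$). More precisely, for every $\alpha\in S_{m,n}$ the tableau $C_{\psi(\alpha)}$ is obtained by rotating the tableau $C_\alpha$ by $180$ degrees.
   Context: Let $m,n$ be positive integers. $N(m,n)$ is the set of all integer vectors $\alpha=(\alpha_1,\dots,\alpha_m)$ with $0\le\alpha_i\le n$ for all $i$. The set $S_{m,n}$ consists of all $\alpha\in N(m,n)$ with $\alpha_m=0$, $\sum_{i=1}^m\alpha_i=k$ for some $0\le k\le\lfloor mn/2\rfloor$, and $\sum_{i=t}^{m-1}\alpha_i\le\sum_{i=t+1}^m(n-\alpha_i)$ for every $1\le t\le m-1$. For $\alpha\in S_{m,n}$ the tableau $C_\alpha$ is built as follows. Take an array of cells with $m$ rows (row $1$ at the top, row $m$ at the bottom) and $n$ columns. For each $i$, the first (leftmost) $\alpha_i$ cells of row $i$ are called fixed. Then, successively for $i=1,2,\dots,m-1$: starting at row $i+1$, read the cells that are neither fixed nor already declared forbidden, from right to left within each row and rows from top to bottom (rows $i+1,i+2,\dots,m$), and declare the first $\alpha_i$ of them forbidden. For $\alpha \in S_{m,n}$ there are always enough cells to do this. The cells that are neither fixed nor forbidden are called fillable. Fill the fillable cells successively with $1,2,3,\dots,\ell$ (where $\ell$ is their number), from left to right within each row and rows from bottom to top. Let $\alpha^E_i$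 be the number of forbidden cells in row $i$; then $\alpha^E_1=0$. Put $S(C_\alpha)=\alpha$ and $E(C_\alpha)=(n-\alpha^E_1,\dots,n-\alpha^E_m)$. The natural involution on $N(m,n)$ is $c^*=(n-c_m,n-c_{m-1},\dots,n-c_1)$, and $\psi$ is the map induced by it: $\psi(S(C_\alpha))=(E(C_\alpha))^*$, which is $\psi(\alpha)=(\alpha^E_m,\alpha^E_{m-1},\dots,\alpha^E_2,0)$. Rotation by $180$ degrees sends the cell in row $i$, column $j$ to the cell in row $m+1-i$, column $n+1-j$. In rotating a tableau, the roles of fixed and forbidden cells are exchanged (images of forbidden cells of $C_\alpha$ are the fixed cells of the new tableau and images of fixed cells are its forbidden cells), fillable cells go to fillable cells, and the numbering of the fillable cells is reversed (the image of the cell with entry $r$ has entry $\ell+1-r$). *)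

(* Defs.v *)
From mathcomp Require Import all_boot.

Set Implicit Arguments.
Unset Strict Implicit.
Unset Printing Implicit Defensive.

(* Rows and columns are numbered from 0, row 0 at the top and column 0 at the
   left, so that rev_ord is i |-> m + 1 - i in the 1-based numbering.  Integer
   vectors between 0 and n are natural-valued, with the bound n in Nset. *)

Definition Nset (m n : nat) : {pred {ffun 'I_m -> nat}} :=
  [pred a : {ffun 'I_m -> nat} | [forall i, a i <= n]].

Arguments Nset m n : clear implicits.

Definition star (m n : nat) (c : {ffun 'I_m -> nat}) : {ffun 'I_m -> nat} :=
  [ffun i => n - c (rev_ord i)].

(* The last condition is the family indexed by 1 <= t <= m - 1, with t shifted
   by one.  Subtraction does not truncate, because a lies in Nset m n. *)
Definition Sset (m n : nat) : {pred {ffun 'I_m -> nat}} :=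
  [pred a : {ffun 'I_m -> nat} |
    [&& a \in Nset m n,
        [forall i : 'I_m, (i.+1 == m) ==> (a i == 0)],
        \sum_(i < m) a i <= (m * n)./2 &
        [forall t : 'I_m, (t.+1 < m) ==>
          (\sum_(i < m | (t <= i) && (i.+1 < m)) a i
             <= \sum_(i < m | t < i) (n - a i))]]].

Arguments Sset m n : clear implicits.

Inductive content := Fixed | Forbidden | Entry of nat.

Definition is_entry (x : content) : bool :=
  if x is Entry _ then true else false.

Definition tableau (m n : nat) := {ffun 'I_m * 'I_n -> content}.

Section Construction.

Variables (m n : nat) (a : {ffun 'I_m -> nat}).

Definition fixed : {set 'I_m * 'I_n} := [set c : 'I_m * 'I_n | c.2 < a c.1].

Definition forbidding_order : seq ('I_m * 'I_n) :=
  [seq (i, j) | i <- enum 'I_m, j <- rev (enum 'I_n)].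

Definition forbid (F : {set 'I_m * 'I_n}) (i : 'I_m) : {set 'I_m * 'I_n} :=
  F :|: [set:: take (a i)
           [seq c : 'I_m * 'I_n <- forbidding_order |
              [&& i < c.1, c \notin fixed & c \notin F]]].

Definition forbidden : {set 'I_m * 'I_n} :=
  foldl forbid set0 [seq i : 'I_m <- enum 'I_m | i.+1 < m].

Definition fillable : {set 'I_m * 'I_n} := ~: (fixed :|: forbidden).

Definition filling_order : seq ('I_m * 'I_n) :=
  [seq (i, j) | i <- rev (enum 'I_m), j <- enum 'I_n].

Definition C : tableau m n :=
  [ffun c => if c \in fixed then Fixed
             else if c \in forbidden then Forbidden
             else Entry (index c [seq d : 'I_m * 'I_n <- filling_order | d \in fillable]).+1].

Definition alphaE (i : 'I_m) : nat := #|[set c : 'I_m * 'I_n in forbidden | c.1 == i]|.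

Definition E : {ffun 'I_m -> nat} := [ffun i => n - alphaE i].

Definition psi : {ffun 'I_m -> nat} :=
  [ffun i : 'I_m => if i.+1 == m then 0 else alphaE (rev_ord i)].

End Construction.

Arguments fixed {m} n a.
Arguments forbidden {m} n a.
Arguments fillable {m} n a.
Arguments C {m} n a.
Arguments alphaE {m} n a i.
Arguments E {m} n a.
Arguments psi {m} n a.

Definition rotate_content (l : nat) (x : content) : content :=
  match x with
  | Fixed => Forbidden
  | Forbidden => Fixed
  | Entry r => Entry (l.+1 - r)
  end.

Definition rotate (m n : nat) (T : tableau m n) : tableau m n :=
  let l := #|[set c | is_entry (T c)]| in
  [ffun c => rotate_content l (T (rev_ord c.1, rev_ord c.2))].

Lemma alphaE_first m n (a : {ffun 'I_m -> nat}) (i : 'I_m) :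
  i = 0 :> nat -> alphaE n a i = 0.
Proof.
move=> i0; apply/eqP; rewrite cards_eq0; apply/eqP/setP=> c.
rewrite !inE; apply/negbTE/negP=> /andP[cF /eqP ci].
suff: 0 < c.1 by rewrite ci i0.
move: cF; rewrite /forbidden; set s := filter _ _.
have: forall d : 'I_m * 'I_n, d \in set0 -> 0 < d.1 by move=> d; rewrite inE.
elim: s (set0 : {set 'I_m * 'I_n}) => [|k s IHs] F HF /=; first exact: HF.
apply: IHs => d; rewrite !inE => /orP[/HF //|/mem_take].
by rewrite mem_filter => /andP[/and3P[kd _ _] _]; apply: leq_ltn_trans kd.
Qed.

Lemma alphaE_le m n (a : {ffun 'I_m -> nat}) (i : 'I_m) : alphaE n a i <= n.
Proof.
rewrite -[X in _ <= X]card_ord -(card_imset _ (f := pair i)) => [|x y []//].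
apply/subset_leq_card/subsetP=> -[r j]; rewrite !inE => /andP[_ /eqP /= ->].
exact: imset_f.
Qed.

(* The last entry 0 in psi is alphaE of the top row, and psi is the map induced
   by star on S(C) |-> E(C). *)
Lemma psi_star m n (a : {ffun 'I_m -> nat}) : psi n a = star n (E n a).
Proof.
apply/ffunP=> i; rewrite !ffunE subKn ?alphaE_le //.
by case: eqP => // im; rewrite alphaE_first //= im subnn.
Qed.

(* Main.v *)
(** Scanning the rows from top to bottom, let D_r be the number of cells that
    the rows above r have still to forbid in rows r, r+1, ...  Whatever the order
    in which the sources are served, row r receives e_r = min(D_r, n - a_r)
    forbidden cells, filling it from the right, and
    D_(r+1) = D_r - e_r + a_r.  The inequalities defining S_(m,n) say exactly
    that D_m = 0.  Reading the recursion backwards, a_r = min(D_(r+1), n - e_r):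
    the same recursion with a and e exchanged and the rows reversed, so psi(a)
    has the reversed sequence D, and its forbidden cells are the images of the
    fixed cells of a. *)

Require Import Defs.
From mathcomp Require Import all_boot zify.

Set Implicit Arguments.
Unset Strict Implicit.
Unset Printing Implicit Defensive.

(** * Recursion for the demand passed down the rows *)

(* [carry s c r] is D_r for sources [s] and capacities [c]; the truncated
   difference [carry s c q - c q] is D_q - min(D_q, c_q). *)
Fixpoint carry (s c : nat -> nat) (r : nat) : nat :=
  if r is q.+1 then carry s c q - c q + s q else 0.

Lemma eq_carry (s s' c c' : nat -> nat) (r : nat) :
  (forall q, q < r -> s q = s' q) -> (forall q, q < r -> c q = c' q) ->
  carry s c r = carry s' c' r.
Proof.
elim: r => [|r IHr] //= es ec; rewrite es // ec // IHr // => q qr.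
  by apply: es; lia.
by apply: ec; lia.
Qed.

Lemma carry_add_source (s c : nat -> nat) (i x r : nat) : i < r ->
  carry (fun q => s q + (if q == i then x else 0)) c r =
  carry s c r + (x - \sum_(i.+1 <= q < r) (c q - carry s c q)).
Proof.
elim: r => [|r IHr] //; rewrite ltnS leq_eqVlt => /orP[/eqP <-|ir] /=.
  rewrite big_geq // eqxx (@eq_carry _ s c c) => [|q qi|//]; first by lia.
  by rewrite ltn_eqF // addn0.
by rewrite IHr // gtn_eqF // big_nat_recr //=; lia.
Qed.

(* With [carry_lower_bound]: D_r is the maximum over t < r of
   \sum_(t <= q < r) s_q - \sum_(t < q < r) c_q. *)
Lemma carry_attained (s c : nat -> nat) (r : nat) : 0 < r ->
  exists2 t, t < r &
    carry s c r + \sum_(t.+1 <= q < r) c q = \sum_(t <= q < r) s q.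
Proof.
elim: r => [|r IHr] // _ /=; case: (leqP (carry s c r) (c r)) => [Dc|cD].
  by exists r => //; rewrite big_geq // big_nat1; lia.
have /IHr[t tr Et] : 0 < r by case: r cD {IHr}.
exists t; first by lia.
by rewrite !big_nat_recr ?(ltnW tr) //=; lia.
Qed.

Lemma carry_lower_bound (s c : nat -> nat) (t r : nat) : t < r ->
  \sum_(t <= q < r) s q <= carry s c r + \sum_(t.+1 <= q < r) c q.
Proof.
elim: r => [|r IHr] //=; rewrite ltnS leq_eqVlt => /orP[/eqP <-|tr].
  by rewrite big_nat1; lia.
by rewrite !big_nat_recr ?(ltnW tr) //=; have := IHr tr; lia.
Qed.

(* Here [s' q] is e in row m - 1 - q. *)
Lemma carry_rev (s s' : nat -> nat) (m n : nat) :
  let D := carry s (fun q => n - s q) in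
  (forall q, s q <= n) -> D m = 0 ->
  (forall q, q < m ->
     s' q = minn (D (m - q.+1)) (n - s (m - q.+1))) ->
  forall k, k <= m -> carry s' (fun q => n - s' q) k = D (m - k).
Proof.
move=> D sn Dm es; elim=> [|k IHk] km /=; first by rewrite subn0.
rewrite IHk ?(ltnW km) // es //.
have -> : m - k = (m - k.+1).+1 by lia.
have DS q : D q.+1 = D q - (n - s q) + s q by [].
(* With [q] for [m - k.+1]: either [D q <= n - s q], so [s' k] is [D q] and [D q.+1] is [s q], or
   the row is saturated and [n - s' k] is [s q]. *)
by have := sn (m - k.+1); rewrite DS; lia.
Qed.

(** * Positions in a list sorted by a strict relation *)

Lemma index_pairwise (T : eqType) (r : rel T) (s : seq T) (x : T) :
  irreflexive r -> (forall y z, r y z -> ~~ r z y) ->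
  pairwise r s -> x \in s -> index x s = count (r^~ x) s.
Proof.
move=> irr asym; elim: s => //= y s IHs /andP[ys ps].
rewrite inE eq_sym; case: eqVneq => [yx _|_ /= xs].
  rewrite yx irr; apply/esym/eqP; rewrite add0n -leqn0 leqNgt -has_count.
  apply/hasPn=> z zs; move/allP: ys => /(_ z zs); rewrite yx; exact: asym.
by rewrite IHs // (allP ys x xs).
Qed.

(** Both reading orders of the cells are instances, with the directions of rows and columns reversed
    from one to the other. *)
Definition lex (S T : eqType) (rS : rel S) (rT : rel T) : rel (S * T) :=
  fun c d => rS c.1 d.1 || (c.1 == d.1) && rT c.2 d.2.

Lemma lex_irr (S T : eqType) (rS : rel S) (rT : rel T) :
  irreflexive rS -> irreflexive rT -> irreflexive (lex rS rT).
Proof. by move=> iS iT c; rewrite /lex iS iT andbF. Qed.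

Lemma lex_asym (S T : eqType) (rS : rel S) (rT : rel T) :
  irreflexive rS -> (forall x y, rS x y -> ~~ rS y x) ->
  (forall x y, rT x y -> ~~ rT y x) ->
  forall c d, lex rS rT c d -> ~~ lex rS rT d c.
Proof.
move=> iS aS aT [x y] [x' y']; rewrite /lex /= [x' == x]eq_sym.
case: eqVneq => [->|_]; first by rewrite iS /=; apply: aT.
by rewrite !andFb !orbF; apply: aS.
Qed.

Lemma pairwise_allpairs (S T : eqType) (rS : rel S) (rT : rel T) s t :
  pairwise rS s -> pairwise rT t ->
  pairwise (lex rS rT) [seq (x, y) | x <- s, y <- t].
Proof.
move=> + pt; elim: s => //= x s IHs /andP[xs ps].
rewrite pairwise_cat IHs // andbT pairwise_map; apply/andP; split.
  apply/allrelP=> _ _ /mapP[y _ ->] /allpairsP[[x' y'] [/= x's _ ->]] /=.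
  by rewrite /lex /= (allP xs).
by apply: sub_pairwise pt => y z yz; rewrite /lex /= eqxx yz orbT.
Qed.

(** Replaces a position in a filtered reading order by a cardinality, both for [take] in [forbid]
    and for the entries of the tableau. *)
Lemma index_filter_card (T : finType) (r : rel T) (P : pred T) (s : seq T) x :
  irreflexive r -> (forall y z, r y z -> ~~ r z y) ->
  pairwise r s -> (forall y, y \in s) -> P x ->
  index x [seq y <- s | P y] = #|[pred y | P y && r y x]|.
Proof.
move=> irr asym ps sT Px.
rewrite (index_pairwise irr asym) ?pairwise_filter ?mem_filter ?Px ?sT //.
rewrite -size_filter -(card_uniqP _); last first.
  exact/filter_uniq/filter_uniq/(pairwise_uniq irr).
by apply: eq_card => y; rewrite !mem_filter sT andbT inE andbC.
Qed.

(** * Counting cells row by row *)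

Lemma card_ord_interval (n x y : nat) :
  #|[pred j : 'I_n | x <= j < y]| = minn y n - x.
Proof.
rewrite -sum1_card (eq_bigl (fun j : 'I_n => (j < y) && (x <= j))); last first.
  by move=> j; rewrite inE andbC.
rewrite -(big_geq_mkord _ _ (fun j => j < y) (fun=> 1)) big_mkcond /=.
elim: n => [|n IHn]; first by rewrite big_geq //; lia.
case: (leqP x n) => xn; last by rewrite big_geq //; lia.
by rewrite big_nat_recr //= IHn; case: ltnP; lia.
Qed.

Lemma card_pairs (I J : finType) (P : I -> pred J) :
  #|[pred c : I * J | P c.1 c.2]| = \sum_i #|P i|.
Proof.
rewrite -sum1_card (eq_bigr _ (fun i _ => esym (sum1_card (P i)))).
by rewrite pair_big_dep.
Qed.

(** * Vectors as functions on the naturals, and their flow *)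

Definition ext (m : nat) (a : {ffun 'I_m -> nat}) (q : nat) : nat :=
  oapp a 0 (insub q).

Lemma extE (m : nat) (a : {ffun 'I_m -> nat}) (i : 'I_m) : ext a i = a i.
Proof. by rewrite /ext valK. Qed.

Lemma ext_out (m : nat) (a : {ffun 'I_m -> nat}) (q : nat) : m <= q -> ext a q = 0.
Proof. by move=> mq; rewrite /ext insubF //; apply/negbTE; rewrite -leqNgt. Qed.

Lemma ext_le (m n : nat) (a : {ffun 'I_m -> nat}) :
  a \in Nset m n -> forall q, ext a q <= n.
Proof.
move=> /forallP an q; case: (ltnP q m) => [qm|/ext_out -> //].
by rewrite -[q]/(val (Ordinal qm)) extE.
Qed.

Definition capacity (m n : nat) (a : {ffun 'I_m -> nat}) (q : nat) := n - ext a q.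

(** The sequence D of [a], with all sources present. *)
Definition flow (m n : nat) (a : {ffun 'I_m -> nat}) : nat -> nat :=
  carry (ext a) (capacity n a).

Lemma pairwise_enum_ord k : pairwise (fun x y : 'I_k => x < y) (enum 'I_k).
Proof.
by rewrite -(pairwise_map val ltn) val_enum_ord -(sorted_pairwise ltn_trans)
  iota_ltn_sorted.
Qed.

Lemma pairwise_rev_enum_ord k :
  pairwise (fun x y : 'I_k => y < x) (rev (enum 'I_k)).
Proof.
have tr : transitive (fun x y : 'I_k => y < x).
  by move=> x y z xy zx; apply: ltn_trans zx xy.
rewrite -(sorted_pairwise tr) rev_sorted.
exact/pairwise_sorted/pairwise_enum_ord.
Qed.

(** * Closed form of the forbidden cells *)

Section Forbidding.

Variables (m n : nat) (a : {ffun 'I_m -> nat}).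

Let above : rel ('I_m * 'I_n) :=
  lex (fun x y : 'I_m => x < y) (fun x y : 'I_n => y < x).

(** Shape of the forbidden set at every stage; [D] is the demand of the sources served so far. *)
Definition right_part (D : nat -> nat) : {set 'I_m * 'I_n} :=
  [set c : 'I_m * 'I_n | n - minn (D c.1) (capacity n a c.1) <= c.2].

Lemma card_above (D : nat -> nat) (i : nat) (c : 'I_m * 'I_n) :
  i < c.1 -> c \notin fixed n a -> c \notin right_part D ->
  #|[pred d : 'I_m * 'I_n |
      [&& i < d.1, d \notin fixed n a & d \notin right_part D] && above d c]|
  = \sum_(i.+1 <= q < c.1) (capacity n a q - D q) + (n - D c.1 - c.2.+1).
Proof.
case: c => r j /= ir; rewrite !inE /= -leqNgt -ltnNge => arj jD.
have im : i < m by apply: ltn_trans ir (ltn_ord r).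
(* [G q] is the contribution of row [q], and [P q] the set of columns counted there. *)
pose G q := if i < q < r then capacity n a q - D q
            else if q == r then n - D r - j.+1 else 0.
pose P (q : 'I_m) := [pred k : 'I_n |
  [&& i < q, a q <= k, k < n - minn (D q) (capacity n a q)
    & (q < r) || (q == r) && (j < k)]].
rewrite (eq_card (B := [pred d | P d.1 d.2])); last first.
  by case=> q k; rewrite !inE /= -leqNgt -ltnNge -!andbA.
rewrite (card_pairs P) (eq_bigr (fun q : 'I_m => G q)) => [|q _].
  rewrite -(big_mkord xpredT) (big_cat_nat (n := i.+1)) //=.
  rewrite (big_cat_nat (m := i.+1) (n := r)) ?(ltnW (ltn_ord r)) //=.
  rewrite [X in _ + (_ + X)]big_ltn // /G.
  rewrite big_nat_cond big1 => [|q ?]; last by rewrite !ifF; lia.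
  rewrite [X in _ + (_ + (_ + X))]big_nat_cond.
  rewrite [X in _ + (_ + (_ + X))]big1 => [|q ?]; last by rewrite !ifF; lia.
  rewrite ltnn andbF eqxx addn0 add0n; congr (_ + _).
  by apply: eq_big_nat => q ->.
have aE (p : 'I_m) : capacity n a p = n - a p by rewrite /capacity extE.
rewrite /G /P aE; case: (ltngtP q r) => [qr|rq|/val_inj ->] /=.
- have [iq|qi] := ltnP i q => /=; last by rewrite eq_card0.
  rewrite (eq_card (B := [pred k : 'I_n | a q <= k < n - minn (D q) (n - a q)])).
    by rewrite card_ord_interval; lia.
  by move=> k; rewrite !inE andbT.
- have qr : (q == r) = false by apply/negbTE; rewrite -val_eqE gtn_eqF.
  by rewrite andbF eq_card0 // => k; rewrite inE /= qr !andbF.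
- rewrite ir andbF eqxx /= (eq_card (B := [pred k : 'I_n |
    j.+1 <= k < n - minn (D r) (n - a r)])).
    by rewrite card_ord_interval; move: jD; rewrite aE; lia.
  by move=> k; rewrite !inE /=; apply/idP/idP; lia.
Qed.

Lemma fixed_right_part (D : nat -> nat) (c : 'I_m * 'I_n) :
  c \in fixed n a -> c \notin right_part D.
Proof.
by rewrite !inE /capacity extE -ltnNge; have := ltn_ord c.2; lia.
Qed.

Lemma above_irr : irreflexive above.
Proof. by apply: lex_irr => x; apply: ltnn. Qed.

Lemma above_asym c d : above c d -> ~~ above d c.
Proof.
by apply: lex_asym => [x|x y|x y]; rewrite ?ltnn // -leqNgt; apply: ltnW.
Qed.

Lemma mem_forbidding_order c : c \in forbidding_order m n.
Proof.
by case: c => r j; rewrite allpairs_f ?mem_rev ?mem_enum.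
Qed.

(** A free cell below row [i] becomes forbidden when fewer than [a i] such cells precede it. By
    [card_above] and [carry_add_source] this says that the increased demand in its row reaches
    it. *)
Lemma forbid_right_part (s : nat -> nat) (i : 'I_m) :
  forbid a (right_part (carry s (capacity n a))) i =
  right_part (carry (fun q => s q + (if q == i :> nat then a i else 0)) (capacity n a)).
Proof.
set D := carry s _; set D' := carry _ _; apply/setP=> c.
rewrite /forbid in_setU [c \in [set:: _] ]inE.
have [cfix|cfree] := boolP (c \in fixed n a).
  rewrite !(negbTE (fixed_right_part _ cfix)) /=; apply/negP=> /mem_take.
  by rewrite mem_filter cfix andbF.
(* Down to row [i] nothing is added, and the demand there depends only on sources above [i]. *)
have [ic|ci] := ltnP i c.1; last first.
  rewrite [_ \in take _ _](_ : _ = false); last first.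
    by apply/negP=> /mem_take; rewrite mem_filter ltnNge ci.
  rewrite orbF !inE /D' (@eq_carry _ s _ (capacity n a)) // => q qc.
  by rewrite ltn_eqF ?addn0 //; apply: leq_trans ci.
have D'E : D' c.1 = D c.1 + (a i - \sum_(i.+1 <= q < c.1) (capacity n a q - D q)).
  exact: carry_add_source.
have [cD|cD] /= := boolP (c \in right_part D).
  by apply/esym; move: cD; rewrite !inE D'E; move: (\sum_(_ <= q < _) _) (D _) (capacity _ _ _) => x y z; lia.
rewrite in_take ?mem_filter ?ic ?cfree ?cD ?mem_forbidding_order //.
rewrite (index_filter_card above_irr above_asym) ?ic ?cfree ?cD //; last first.
- exact: mem_forbidding_order.
- exact: pairwise_allpairs (pairwise_enum_ord _) (pairwise_rev_enum_ord _).
rewrite card_above // [RHS]inE D'E; move: cD cfree (ltn_ord c.2).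
rewrite !inE; move: (\sum_(_ <= q < _) _) => x; rewrite /capacity extE -!ltnNge; move: (D _) (a c.1) (a i) (nat_of_ord c.2) => d u v j *.
apply/idP/idP; lia.
Qed.

(** Invariant of the construction: sources not yet served count as 0. *)
Lemma foldl_forbid k : k <= m ->
  foldl (forbid a) set0 (take k (enum 'I_m)) =
  right_part (carry (fun q => if q < k then ext a q else 0) (capacity n a)).
Proof.
elim: k => [_|k IHk km].
  apply/setP=> c; rewrite take0 /= !inE.
  rewrite [carry _ _ _](_ : _ = 0) ?min0n ?subn0 1?leqNgt ?ltn_ord //.
  by elim: {c}(val c.1) => //= q ->.
rewrite (take_nth (Ordinal km)) ?size_enum_ord // foldl_rcons IHk ?(ltnW km) //.
rewrite -[k in nth _ _ k]/(val (Ordinal km)) nth_ord_enum forbid_right_part.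
apply/setP=> c; rewrite !inE; congr (n - minn _ _ <= _).
apply: eq_carry => // q _; rewrite -extE /=.
by rewrite ltnS [q <= k]leq_eqVlt; case: (ltngtP q k) => [||->] /=; rewrite ?addn0.
Qed.

Lemma forbiddenE : forbidden n a = right_part (flow n a).
Proof.
rewrite /forbidden (_ : [seq i <- _ | _] = take m.-1 (enum 'I_m)); last first.
  apply: (inj_map val_inj); rewrite map_take val_enum_ord take_iota.
  rewrite -(filter_map val (fun q => q.+1 < m)) val_enum_ord.
  rewrite (minn_idPl (leq_pred m)) -(filter_iota_ltn _ (leq_pred m)) // add0n.
  by apply: eq_in_filter => q; rewrite mem_iota; lia.
rewrite foldl_forbid ?leq_pred //; apply/setP=> c; rewrite !inE.
(* The demand in a row involves only sources strictly above it, all with index below [m.-1]. *)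
congr (n - minn _ _ <= _); apply: eq_carry => // q qc.
by rewrite ifT // ltn_predRL; apply: leq_trans (ltn_ord c.1).
Qed.

End Forbidding.

(** * [psi] and membership in S in terms of the flow *)

Lemma flow_succ (m n : nat) (a : {ffun 'I_m -> nat}) q :
  flow n a q.+1 = flow n a q - (n - ext a q) + ext a q.
Proof. by []. Qed.

Lemma alphaEE (m n : nat) (a : {ffun 'I_m -> nat}) (i : 'I_m) :
  alphaE n a i = minn (flow n a i) (n - a i).
Proof.
rewrite /alphaE forbiddenE.
pose P (q : 'I_m) := [pred k : 'I_n |
  (q == i) && (n - minn (flow n a i) (n - a i) <= k < n)].
rewrite (eq_card (B := [pred d | P d.1 d.2])); last first.
  case=> q k; rewrite !inE /= ltn_ord andbT andbC; case: eqP => [->|] //=.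
  by rewrite /capacity extE.
rewrite (card_pairs P) (bigD1 i) //= [X in _ + X]big1 => [|q qi]; last first.
  by rewrite eq_card0 // => k; rewrite inE /= (negbTE qi).
rewrite addn0 /P eqxx /= card_ord_interval; lia.
Qed.

Lemma ext_psi (m n : nat) (a : {ffun 'I_m -> nat}) (q : nat) : q < m ->
  ext (psi n a) q = minn (flow n a (m - q.+1)) (n - ext a (m - q.+1)).
Proof.
move=> qm; rewrite -[q in LHS]/(val (Ordinal qm)) extE ffunE /=.
(* The last entry 0 agrees with the general formula, since the flow into row 0 is 0. *)
have [qm1|_] := eqP; first by rewrite (_ : m - q.+1 = 0) ?qm1 ?subnn // min0n.
by rewrite alphaEE -extE.
Qed.

(** By the maximum formula, D_m = 0 is a family of inequalities indexed by all [t < m]; the case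
    [t = m - 1] says that the last entry is 0. *)
Lemma SsetP (m n : nat) (a : {ffun 'I_m -> nat}) : 0 < m ->
  reflect ((forall q, ext a q <= n) /\ flow n a m = 0) (a \in Sset m n).
Proof.
case: m a => // m a _.
have sum_low t : \sum_(i < m.+1 | (t <= i) && (i.+1 < m.+1)) a i =
    \sum_(t <= q < m) ext a q.
  rewrite (big_nat_widen _ _ m.+1) // big_geq_mkord; apply: eq_big => i.
    by rewrite andbC ltnS.
  by rewrite extE.
have sum_cap t : \sum_(i < m.+1 | t < i) (n - a i) =
    \sum_(t.+1 <= q < m.+1) (n - ext a q).
  by rewrite big_geq_mkord; apply: eq_bigr => i _; rewrite extE.
have sum_all : \sum_(i < m.+1) a i = \sum_(0 <= q < m.+1) ext a q.
  by rewrite big_mkord; apply: eq_bigr => i _; rewrite extE.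
apply: (iffP idP) => [/and4P[/ext_le an /forallP /(_ ord_max) am _ /forallP St]|[an Dm]].
  split=> //; move: am; rewrite /= eqxx /= -extE /= => /eqP am.
  (* Here [m] indexes the last row. The maximizing [t] is either [m], where the last entry is 0, or
     covered by its own inequality. *)
  have [t] := @carry_attained (ext a) (capacity n a) m.+1 isT.
  rewrite ltnS leq_eqVlt -/(flow n a m.+1) => /orP[/eqP ->|tm] Et.
    by move: Et; rewrite big_geq // big_nat1 am addn0.
  move: Et; rewrite [RHS]big_nat_recr ?(ltnW tm) //= am addn0 => Et.
  have := St (inord t); rewrite inordK ?ltnS ?(ltnW tm) // tm /= sum_low sum_cap.
  by rewrite -Et -[X in _ <= X]add0n leq_add2r leqn0 => /eqP.
have bound t : t < m.+1 ->
    \sum_(t <= q < m.+1) ext a q <= \sum_(t.+1 <= q < m.+1) (n - ext a q).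
  move=> tm; have := @carry_lower_bound (ext a) (capacity n a) t m.+1 tm.
  by rewrite -/(flow n a m.+1) Dm.
have am : ext a m = 0.
  by have := bound m (ltnSn m); rewrite big_nat1 big_geq // leqn0 => /eqP.
apply/and4P; split.
- by apply/forallP=> i; rewrite -extE.
- apply/forallP=> i; apply/implyP=> /eqP[im].
  by rewrite -extE im am.
(* The case [t = 0] bounds the total by the sum of the complements, and the two add up to
   [m.+1 * n]. *)
- rewrite sum_all; have := bound 0 isT.
  have : \sum_(0 <= q < m.+1) ext a q + \sum_(0 <= q < m.+1) (n - ext a q) = m.+1 * n.
    rewrite -big_split /= (eq_bigr (fun=> n)) => [|q _]; last by rewrite subnKC.
    by rewrite sum_nat_const_nat subn0.
  rewrite [\sum_(0 <= q < _) (n - _)]big_ltn //.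
  move: (\sum_(0 <= q < _) _) (\sum_(1 <= q < _) _) (_ * _) => x y z; lia.
- apply/forallP=> t; apply/implyP=> tm.
  rewrite sum_low sum_cap; apply: leq_trans (bound t (ltn_ord t)).
  by rewrite big_nat_recr ?leq_ord //= leq_addr.
Qed.

(** * Rotation of the tableau *)

Section Rotation.

Variables (m n : nat) (a : {ffun 'I_m -> nat}).
Hypotheses (m_gt0 : 0 < m) (aS : a \in Sset m n).

Let an : forall q, ext a q <= n.
Proof. by have [] := SsetP n a m_gt0 aS. Qed.

Let Dm : flow n a m = 0.
Proof. by have [] := SsetP n a m_gt0 aS. Qed.

Lemma psi_le q : ext (psi n a) q <= n.
Proof.
have [qm|mq] := ltnP q m; last by rewrite ext_out.
by rewrite ext_psi //; lia.
Qed.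

Lemma flow_psi q : q <= m -> flow n (psi n a) q = flow n a (m - q).
Proof. by apply: carry_rev => // k km; rewrite ext_psi. Qed.

Lemma psi_Sset : psi n a \in Sset m n.
Proof.
apply/SsetP => //; split=> [q|]; first exact: psi_le.
by rewrite flow_psi // subnn.
Qed.

(** The backward recursion a_r = min(D_(r+1), n - e_r), read through the reversed flow of
    [psi n a]. *)
Lemma alphaE_psi (i : 'I_m) : alphaE n (psi n a) i = a (rev_ord i).
Proof.
rewrite alphaEE -extE ext_psi // flow_psi ?(ltnW (ltn_ord i)) //.
have -> : m - i = (m - i.+1).+1 by have := ltn_ord i; lia.
rewrite flow_succ -[a _]extE /=; have := an (m - i.+1); lia.
Qed.

Lemma psiE (i : 'I_m) : psi n a i = alphaE n a (rev_ord i).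
Proof. by rewrite alphaEE -!extE ext_psi. Qed.

Let rot (c : 'I_m * 'I_n) : 'I_m * 'I_n := (rev_ord c.1, rev_ord c.2).

Let before : rel ('I_m * 'I_n) :=
  lex (fun x y : 'I_m => y < x) (fun x y : 'I_n => x < y).

Lemma rotK : involutive rot.
Proof. by case=> r j; rewrite /rot /= !rev_ordK. Qed.

(** Forbidden cells are right-justified, so rotating a row of them gives an initial segment, whose
    length is the entry of [psi n a]. *)
Lemma fixed_psi c : (c \in fixed n (psi n a)) = (rot c \in forbidden n a).
Proof.
rewrite forbiddenE !inE psiE // alphaEE /capacity extE.
have := ltn_ord c.2; move: (flow _ _ _) (a _) => d x /= ?.
by apply/idP/idP; lia.
Qed.

Lemma forbidden_psi c : (c \in forbidden n (psi n a)) = (rot c \in fixed n a).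
Proof.
have := alphaE_psi c.1; rewrite alphaEE forbiddenE !inE /capacity extE => ->.
have := an (rev_ord c.1); rewrite extE; have := ltn_ord c.2.
by rewrite /=; move: (a _) (nat_of_ord c.2) => x j ? ?; apply/idP/idP; lia.
Qed.

Lemma fillable_psi c : (c \in fillable n (psi n a)) = (rot c \in fillable n a).
Proof. by rewrite /fillable !in_setC !in_setU fixed_psi forbidden_psi orbC. Qed.

Lemma before_irr : irreflexive before.
Proof. by apply: lex_irr => x; apply: ltnn. Qed.

Lemma before_asym c d : before c d -> ~~ before d c.
Proof.
by apply: lex_asym => [x|x y|x y]; rewrite ?ltnn // -leqNgt; apply: ltnW.
Qed.

Lemma before_total c d : c != d -> ~~ before d c = before c d.
Proof.
move=> cd; apply/idP/idP=> [|/before_asym //]; apply: contraR => ncd.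
move: cd ncd; case: c d => [r j] [q k]; rewrite xpair_eqE /before /lex /= -!val_eqE /=.
by case: (ltngtP r q) => //= _; case: (ltngtP j k).
Qed.

Lemma before_rot c d : before (rot c) (rot d) = before d c.
Proof.
case: c d => [r j] [q k]; rewrite /before /lex /= (inj_eq rev_ord_inj) eq_sym.
by rewrite !ltn_sub2lE // !ltnS.
Qed.

Lemma index_filling (b : {ffun 'I_m -> nat}) c : c \in fillable n b ->
  index c [seq d <- filling_order m n | d \in fillable n b] =
  #|[set d in fillable n b | before d c]|.
Proof.
move=> cb; rewrite (index_filter_card before_irr before_asym) ?cb //.
- by rewrite cardsE.
- exact: pairwise_allpairs (pairwise_rev_enum_ord _) (pairwise_enum_ord _).
- by case=> r j; rewrite allpairs_f ?mem_rev ?mem_enum.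
Qed.

(** Rotation preserves fillability and reverses [before]. *)
Lemma card_before_psi c :
  #|[set d in fillable n (psi n a) | before d c]| =
  #|[set d in fillable n a | before (rot c) d]|.
Proof.
rewrite -(card_preimset _ (inv_inj rotK)).
apply: eq_card => d; rewrite [LHS]in_set [LHS]in_set [RHS]in_set.
by rewrite fillable_psi rotK -[c in LHS]rotK before_rot.
Qed.

(** [before] is a strict total order, so every other fillable cell comes either before or after
    [c]. *)
Lemma card_fillable c : c \in fillable n a ->
  #|fillable n a| = (#|[set d in fillable n a | before d c]| +
                     #|[set d in fillable n a | before c d]|).+1.
Proof.
move=> cf; rewrite (cardsD1 c) cf -(cardsID [set d | before d c]) add1n.
congr (_ + _).+1; apply: eq_card => d; rewrite [RHS]in_set.
  rewrite in_setI in_setD1 in_set; case: eqVneq => //= ->.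
  by rewrite before_irr andbF.
rewrite in_setD in_setD1 in_set; case: eqVneq => [->|dc] /=; first by rewrite before_irr !andbF.
by rewrite before_total 1?eq_sym // andbC.
Qed.

Lemma C_psi : C n (psi n a) = rotate (C n a).
Proof.
apply/ffunP=> c; rewrite !ffunE fixed_psi forbidden_psi -/(rot c).
have [cF|cnF] := boolP (rot c \in forbidden n a).
  (* [C] tests [fixed] first, and rotation exchanges the two tests; disjointness of the two sets
     reconciles them. *)
  rewrite ifF //; apply: contraTF cF; rewrite forbiddenE.
  exact: fixed_right_part.
have [//|cnf] := boolP (rot c \in fixed n a).
have cfill : rot c \in fillable n a.
  by rewrite in_setC in_setU negb_or cnf.
rewrite [#|_|](_ : _ = #|fillable n a|); last first.
  apply: eq_card => d; rewrite inE ffunE in_setC in_setU.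
  by case: (d \in fixed n a); case: (d \in forbidden n a).
rewrite /= !index_filling ?fillable_psi // card_before_psi (card_fillable cfill).
(* With p cells before [rot c] and q after it, l = p + q + 1, so the entry p + 1 becomes q + 1. *)
by rewrite subSS subSn ?leq_addr // addKn.
Qed.

End Rotation.

Theorem theorem13 (m n : nat) (hm : 0 < m) (hn : 0 < n) :
  [/\ forall a : {ffun 'I_m -> nat}, a \in Sset m n -> psi n a \in Sset m n,
      forall a : {ffun 'I_m -> nat}, a \in Sset m n -> psi n (psi n a) = a
    & forall a : {ffun 'I_m -> nat}, a \in Sset m n ->
        C n (psi n a) = rotate (C n a)].
Proof.
split=> a aS; [exact: psi_Sset| |exact: C_psi].
apply/ffunP=> i; rewrite psiE ?psi_Sset //.
by rewrite alphaE_psi // rev_ordK.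
Qed.
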